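(* Let $p_1,q_1,p_2,q_2$ be real numbers with $1\le p_1\le q_1<\infty$ and $1\le p_2\le q_2<\infty$. If $p_1\le p_2$ and $\frac{q_1}{q_2}\le\frac{p_1}{p_2}$, then $\ell^{p_1}_{q_1}\subseteq\ell^{p_2}_{q_2}$, with $\|x\|_{\ell^{p_2}_{q_2}}\le\|x\|_{\ell^{p_1}_{q_1}}$ for every $x\in\ell^{p_1}_{q_1}$. Moreover, $\ell^{p_2}_{q_2}\setminus\ell^{p_1}_{q_1}\neq\emptyset$ whenever ($p_1<p_2$ and $\frac{q_1}{q_2}\le\frac{p_1}{p_2}$) or ($p_1\le p_2$ and $\frac{q_1}{q_2}<\frac{p_1}{p_2}$).
   Context: For $m\in\mathbb{Z}$ and $N\in\mathbb{N}_0=\mathbb{N}\cup\{0\}$ let $S_{m,N}:=\{m-N,\ldots,m,\ldots,m+N\}\subset\mathbb{Z}$, so $|S_{m,N}|=2N+1$. For $1\le p\le q<\infty$, the discrete Morrey space $\ell^p_q=\ell^p_q(\mathbb{Z})$ is the set of all scalar sequences $x=(x_j)_{j\in\mathbb{Z}}$ such that $$\|x\|_{\ell^p_q}:=\sup_{m\in\mathbb{Z},\,N\in\mathbb{N}_0}|S_{m,N}|^{\frac1q-\frac1p}\Big(\sum_{j\in S_{m,N}}|x_j|^p\Big)^{\frac1p}<\infty.$$ *)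

(* Defs.v *)
From HB Require Import structures.
From mathcomp Require Import all_boot all_order all_algebra zify.
From mathcomp Require Import finmap.
From mathcomp Require Import all_classical all_reals all_analysis.
From mathcomp Require Import complex.
Set Implicit Arguments.
Unset Strict Implicit.
Unset Printing Implicit Defensive.
Import Order.TTheory GRing.Theory Num.Theory.
Local Open Scope classical_set_scope.
Local Open Scope ring_scope.

(* "Scalar" means real or complex. [Rcomplex R] is the alias of [R[i]] whose
   norm (the complex modulus) takes its values in [R]. *)
Variant scalar_kind := RealScalars | ComplexScalars.

Definition scalar_field (R : realType) (k : scalar_kind) : normedZmodType R :=
  match k with
  | RealScalars => R
  | ComplexScalars => Rcomplex R
  end.

Definition window (m : int) (N : nat) : set int :=
  [set j | m - N%:Z <= j <= m + N%:Z].

Lemma windowE m N :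
  window m N = [set` [seq m - N%:Z + k%:Z | k <- iota 0 N.*2.+1]].
Proof.
apply/seteqP; split=> j.
- move=> /andP[jl jr]; apply: (introT mapP).
  exists (absz (j - (m - N%:Z))%R); last by lia.
  by rewrite mem_iota; lia.
- move=> /(elimT mapP)[k]; rewrite mem_iota => hk ->.
  by apply/andP; split; lia.
Qed.

Lemma finite_window m N : finite_set (window m N).
Proof. by rewrite windowE; exact: finite_seq. Qed.

Lemma card_window m N : #|` fset_set (window m N)|%fset = N.*2.+1.
Proof.
rewrite windowE; set s := [seq _ | k <- _].
have us : uniq s by rewrite map_inj_uniq ?iota_uniq// => a b; lia.
have -> : [set` s] = [set` seq_fset tt s].
  by apply/seteqP; split=> x; rewrite /mkset seq_fsetE.
by rewrite set_fsetK size_seq_fset undup_id// size_map size_iota.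
Qed.

Section Morrey.
Context {R : realType} {V : normedZmodType R}.
Implicit Types (p q : R) (x : int -> V).

Definition morrey_term p q x (m : int) (N : nat) : R :=
  (#|` fset_set (window m N)|%fset)%:R `^ (q^-1 - p^-1) *
  (\sum_(j \in window m N) `|x j| `^ p) `^ p^-1.

Definition morrey_norm p q x : \bar R :=
  ereal_sup [set (morrey_term p q x m N)%:E | m in [set: int] & N in [set: nat]].

Definition morrey p q : set (int -> V) :=
  [set x | (morrey_norm p q x < +oo)%E].

End Morrey.
Arguments morrey {R} V p q.

(* Main.v *)
(** If [M] is the norm of [x] in [ℓ^p1_q1], windows with [N = 0] give
    [|x_j| <= M], hence [|x_j|^p2 <= M^(p2-p1) |x_j|^p1]; summing over a window
    of size [n] bounds the [p2]-sum by [M^p2 n^(1-p1/q1) <= M^p2 n^(1-p2/q2)].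

    For strictness, either alternative forces [q1 < q2].  Pick
    [1/q2 < s < 1/q1] and let [x_j = (j+1)^(-s)] for [j >= 0] and [0] otherwise.
    Then [x] is in [ℓ^q2], which embeds in [ℓ^p2_q2], while over [0..n-1] every
    term is at least [n^(-s)], so the [(p1,q1)]-term is at least [n^(1/q1-s)]. *)
Require Import Defs.
From mathcomp Require Import all_boot all_order all_algebra zify.
From mathcomp Require Import all_classical all_reals all_analysis.
From mathcomp Require Import complex.
From mathcomp Require Import ring lra.
Set Implicit Arguments.
Unset Strict Implicit.
Unset Printing Implicit Defensive.
Import Order.TTheory GRing.Theory Num.Theory.
Local Open Scope classical_set_scope.
Local Open Scope ring_scope.

(** * Real powers and sums of powers *)

Lemma powR_inv_le (R : realType) (p a b : R) : 0 < p -> 0 <= a -> 0 <= b ->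
  (a `^ p^-1 <= b) = (a <= b `^ p).
Proof.
move=> p0 a0 b0; have pV0 : 0 < p^-1 by rewrite invr_gt0.
apply/idP/idP => h.
- have := ge0_ler_powR (ltW p0) _ _ h; rewrite !nnegrE => /(_ (powR_ge0 _ _) b0).
  by rewrite -powRrM mulVf ?gt_eqF// powRr1.
- have := ge0_ler_powR (ltW pV0) _ _ h; rewrite !nnegrE => /(_ a0 (powR_ge0 _ _)).
  by rewrite -powRrM mulfV ?gt_eqF// powRr1.
Qed.

Lemma ler_sum_ord_widen (R : realType) (f : nat -> R) (m n : nat) :
  (m <= n)%N -> (forall i, 0 <= f i) -> \sum_(i < m) f i <= \sum_(i < n) f i.
Proof.
move=> mn f0; rewrite -!(big_mkord xpredT f) [leRHS](big_cat_nat (leq0n m) mn) lerDl.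
by rewrite sumr_ge0.
Qed.

(* Splitting into odd and even integers gives [S_(2n+1) <= 1 + 2^(1-s) S_n],
   where [S_n] is the n-th partial sum; then [S_n <= S_(2n+1)]. *)
Lemma sum_riemannR_le (R : realType) (s : R) (n : nat) : 1 < s ->
  \sum_(i < n) riemannR s i <= (1 - 2 `^ (1 - s))^-1.
Proof.
move=> s1; have s0 : 0 <= s by lra.
have r0 i : 0 <= riemannR s i by exact/ltW/riemannR_gt0.
have c1 : 2 `^ (1 - s) < 1 :> R.
  rewrite -[ltRHS](powRr0 2) -subr_gt0 /powR !gt_eqF// subr_gt0 ltr_expR.
  by rewrite ltr_pM2r ?ln_gt0 ?ltr1n//; lra.
have E k : \sum_(i < k.*2.+1) riemannR s i <=
    1 + 2 `^ (1 - s) * \sum_(i < k) riemannR s i.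
  rewrite /riemannR; elim: k => [|k IH].
    by rewrite big_ord_recr !big_ord0 /= powR1 invr1 mulr0 addr0 add0r.
  rewrite doubleS 2!big_ord_recr [in leRHS]big_ord_recr /= mulrDr addrA -addrA.
  apply: lerD => //.
  (* The step adds [(2k+2)^(-s)] and [(2k+3)^(-s)]; both are at most [(2k+2)^(-s)], and twice that
     is [2^(1-s) (k+1)^(-s)]. *)
  have -> : 2 `^ (1 - s) * (k.+1%:R `^ s)^-1 =
      (k.*2.+2%:R `^ s)^-1 + (k.*2.+2%:R `^ s)^-1 :> R.
    rewrite -doubleS -muln2 natrM powRM// powRB ?powRr1//; last by rewrite pnatr_eq0 implybT.
    by rewrite invfM; ring.
  rewrite lerD2l lef_pV2 ?posrE ?powR_gt0//.
  by rewrite ge0_ler_powR// ?nnegrE// ler_nat.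
rewrite -[leRHS]mul1r ler_pdivlMr ?subr_gt0//.
have := E n; have : \sum_(i < n) riemannR s i <= \sum_(i < n.*2.+1) riemannR s i.
  by apply: ler_sum_ord_widen => //; lia.
move=> h1 h2; have := le_trans h1 h2.
by rewrite mulrBr mulr1 mulrC; lra.
Qed.

(* Hoelder's inequality without Hoelder: pointwise, [u^p <= t^p + u^q t^(p-q)]
   for every [t > 0]; take [t = n^(-1/q)]. *)
Lemma sum_powR_le (R : realType) (p q : R) (n : nat) (u : nat -> R) :
  0 < p -> p <= q -> (0 < n)%N -> (forall i, 0 <= u i) ->
  \sum_(i < n) u i `^ p <=
    n%:R `^ (1 - p / q) * (1 + \sum_(i < n) u i `^ q).
Proof.
move=> p0 pq n0 u0; have q0 : 0 < q by lra.
have nR0 : 0 < n%:R :> R by rewrite ltr0n.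
set t := n%:R `^ (- q^-1) : R; have t0 : 0 < t by rewrite powR_gt0.
(* This [t] balances the two parts of the summed bound: [n t^p] and [t^(p-q)] are the same power of
   [n]. *)
have tp : n%:R * t `^ p = n%:R `^ (1 - p / q).
  rewrite -powRrM -[X in X * _]powRr1 ?ltW// -powRD ?(gt_eqF nR0) ?implybT//.
  by congr (_ `^ _); ring.
have tpq : t `^ (p - q) = n%:R `^ (1 - p / q).
  by rewrite -powRrM; congr (_ `^ _); field; lra.
apply: (@le_trans _ _ (\sum_(i < n) (t `^ p + u i `^ q * t `^ (p - q)))).
  apply: ler_sum => i _; have [ut|tu] := leP (u i) t.
    by rewrite ler_wpDr ?mulr_ge0 ?powR_ge0// ge0_ler_powR// ?nnegrE ?u0 ?ltW.
  have uu : 0 < u i by exact: lt_trans tu.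
  apply: ler_wpDl; first exact: powR_ge0.
  (* As [t < u] and [p - q <= 0], the factor [u^(p-q)] of [u^p] is at most [t^(p-q)]. *)
  rewrite -[p in leLHS](subrK q) [leLHS]powRD ?(gt_eqF uu) ?implybT// mulrC.
  rewrite ler_wpM2l ?powR_ge0// -opprB 2!powRN lef_pV2 ?posrE ?powR_gt0//.
  by rewrite ge0_ler_powR ?nnegrE ?subr_ge0 ?(ltW tu) ?(ltW t0).
rewrite big_split /= sumr_const card_ord -mulr_suml -[X in X + _]mulr_natl tp tpq.
by rewrite mulrDr mulr1 [X in _ + X]mulrC.
Qed.

(** * Morrey norms and the inclusion *)

Section Morrey.
Context {R : realType} {V : normedZmodType R}.
Implicit Types (p q M : R) (x : int -> V).

Lemma morrey_termE p q x m N : morrey_term p q x m N =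
  N.*2.+1%:R `^ (q^-1 - p^-1) *
  (\sum_(k < N.*2.+1) `|x (m - N%:Z + k%:Z)| `^ p) `^ p^-1.
Proof.
rewrite /morrey_term card_window windowE -fsbig_seq; last first.
  by rewrite map_inj_uniq ?iota_uniq// => a b; lia.
rewrite big_map -(big_mkord xpredT (fun k => `|x (m - N%:Z + k%:Z)| `^ p)).
by rewrite /index_iota subn0.
Qed.

(** Since [1/q - 1/p = -(1 - p/q)/p], raising to the power [p] clears the outer root, and later
    estimates deal with plain [p]-sums only. *)
Lemma morrey_term_le p q x m N M : 0 < p -> 0 <= M ->
  (morrey_term p q x m N <= M) =
  (\sum_(k < N.*2.+1) `|x (m - N%:Z + k%:Z)| `^ p
     <= M `^ p * N.*2.+1%:R `^ (1 - p / q)).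
Proof.
move=> p0 M0; rewrite morrey_termE.
set S := \sum_(k < _) _; have S0 : 0 <= S.
  by rewrite sumr_ge0// => k _; exact: powR_ge0.
have -> : q^-1 - p^-1 = - (1 - p / q) * p^-1.
  by rewrite opprB mulrBl mul1r mulrAC mulfV ?gt_eqF// mul1r.
rewrite powRrM -powRM ?powR_ge0// powR_inv_le ?mulr_ge0 ?powR_ge0//.
by rewrite powRN mulrC ler_pdivrMr ?powR_gt0.
Qed.

Lemma morrey_norm_le p q x M :
  (morrey_norm p q x <= M%:E)%E <-> forall m N, morrey_term p q x m N <= M.
Proof.
split=> [h m N|h].
- rewrite -lee_fin; apply: le_trans h; apply: ereal_sup_ubound.
  by exists m => //; exists N.
- by apply: ge_ereal_sup => _ [m _ [N _ <-]]; rewrite lee_fin.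
Qed.

Lemma morrey_term_ge0 p q x m N : 0 <= morrey_term p q x m N.
Proof. by rewrite mulr_ge0 ?powR_ge0. Qed.

Lemma morrey_norm_ge0 p q x : (0 <= morrey_norm p q x)%E.
Proof.
apply: le_trans (_ : (morrey_term p q x 0 0)%:E <= _)%E.
  by rewrite lee_fin morrey_term_ge0.
by apply: ereal_sup_ubound; exists 0 => //; exists 0%N.
Qed.

Lemma morreyP p q x : morrey V p q x <->
  exists2 M, 0 <= M & forall m N, morrey_term p q x m N <= M.
Proof.
split=> [|[M _ /morrey_norm_le h]]; last exact: le_lt_trans h (ltry _).
rewrite /morrey /=; have := morrey_norm_ge0 p q x.
case E : (morrey_norm p q x) => [M| |]// M0 _.
by exists M; [rewrite -lee_fin|apply/morrey_norm_le; rewrite E].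
Qed.

Lemma morrey_term_mono p1 q1 p2 q2 x M :
  0 < p1 -> 0 < q1 -> 0 < q2 -> p1 <= p2 -> q1 / q2 <= p1 / p2 -> 0 <= M ->
  (forall m N, morrey_term p1 q1 x m N <= M) ->
  forall m N, morrey_term p2 q2 x m N <= M.
Proof.
move=> p10 q10 q20 p12 hq M0 h m N; have p20 : 0 < p2 by lra.
have xM j : `|x j| <= M.
  have := h j 0%N; rewrite morrey_term_le// big_ord_recr big_ord0 /= add0r.
  rewrite subr0 addr0 powR1 mulr1 => hj.
  have -> : M = (M `^ p1) `^ p1^-1 by rewrite -powRrM mulfV ?gt_eqF// powRr1.
  have -> : `|x j| = (`|x j| `^ p1) `^ p1^-1.
    by rewrite -powRrM mulfV ?gt_eqF// powRr1.
  by rewrite ge0_ler_powR ?nnegrE ?powR_ge0// invr_ge0 ltW.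
(* This includes [a = 0], because [p2] is nonzero. *)
have powE (a : R) : a `^ p2 = a `^ (p2 - p1) * a `^ p1.
  by rewrite -powRD subrK// (gt_eqF p20).
have := h m N; rewrite !morrey_term_le// => hm.
apply: (@le_trans _ _ (M `^ (p2 - p1) *
    \sum_(k < N.*2.+1) `|x (m - N%:Z + k%:Z)| `^ p1)).
  rewrite mulr_sumr; apply: ler_sum => k _; rewrite powE ler_wpM2r ?powR_ge0//.
  by rewrite ge0_ler_powR ?nnegrE ?subr_ge0.
apply: le_trans (ler_wpM2l (powR_ge0 _ _) hm) _.
(* With window size at least 1, it remains to compare exponents: [p2/q2 <= p1/q1], which is [hq]
   cross-multiplied. *)
rewrite mulrA -powE ler_wpM2l ?powR_ge0// ler_powR ?ler1n// lerD2l lerN2.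
move: hq; rewrite ler_pdivrMr// mulrAC ler_pdivlMr// => hq.
by rewrite ler_pdivrMr// mulrAC ler_pdivlMr// mulrC.
Qed.

Lemma morrey_norm_mono p1 q1 p2 q2 x :
  0 < p1 -> 0 < q1 -> 0 < q2 -> p1 <= p2 -> q1 / q2 <= p1 / p2 ->
  morrey V p1 q1 x -> (morrey_norm p2 q2 x <= morrey_norm p1 q1 x)%E.
Proof.
move=> p10 q10 q20 p12 hq; have := morrey_norm_ge0 p1 q1 x.
rewrite /morrey /=; case E : (morrey_norm p1 q1 x) => [M| |]// M0 _.
apply/morrey_norm_le; apply: morrey_term_mono hq _ _ => //.
by apply/morrey_norm_le; rewrite E.
Qed.

End Morrey.

(** * The one-sided decaying sequence *)

Definition half_decay (R : realType) (s : R) (j : int) : R :=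
  if j is Posz n then n.+1%:R `^ (- s) else 0.

Lemma half_decay_ge0 (R : realType) (s : R) j : 0 <= half_decay s j.
Proof. by case: j => n //=; exact: powR_ge0. Qed.

Lemma half_decay_powR (R : realType) (s q : R) j : 0 < q ->
  half_decay s j `^ q = half_decay (s * q) j.
Proof.
by move=> q0; case: j => n /=; rewrite ?powR0 ?gt_eqF// -powRrM mulNr.
Qed.

(** From a start [z >= 0] the terms are [(z+k+1)^(-s) <= (k+1)^(-s)]. From a negative start the
    first term is zero; dropping it leaves a shorter sum starting one step to the right, covered by
    induction. *)
Lemma sum_half_decay_le (R : realType) (s : R) (n : nat) (z : int) : 0 <= s ->
  \sum_(k < n) half_decay s (z + k%:Z) <= \sum_(k < n) riemannR s k.
Proof.
move=> s0; elim: n z => [|n IH] [z|z]; rewrite ?big_ord0//.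
- apply: ler_sum => k _; rewrite -PoszD /= powRN lef_pV2 ?posrE ?powR_gt0//.
  by rewrite ge0_ler_powR ?nnegrE// ler_nat; lia.
- rewrite big_ord_recl [X in X + _](_ : _ = 0) ?add0r; last by rewrite addr0.
  apply: (@le_trans _ _ (\sum_(k < n) riemannR s k)).
    apply: le_trans (IH (Negz z + 1)); apply: ler_sum => k _.
    by rewrite lift0 intS addrA.
  by apply: ler_sum_ord_widen => // i; exact/ltW/riemannR_gt0.
Qed.

Lemma half_decay_morrey (R : realType) (V : normedZmodType R) (f : R -> V)
    (p q s : R) : (forall r, 0 <= r -> `|f r| = r) ->
  0 < p -> p <= q -> q^-1 < s -> morrey V p q (f \o half_decay s).
Proof.
move=> fE p0 pq qs; have q0 : 0 < q by lra.
have sq1 : 1 < s * q by rewrite -ltr_pdivrMr// div1r.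
set C := 1 + (1 - 2 `^ (1 - s * q))^-1.
have C0 : 0 <= C.
  (* The inverse is nonnegative because it bounds the empty sum. *)
  rewrite addr_ge0// (le_trans _ (@sum_riemannR_le _ (s * q) 0 sq1))//.
  by rewrite big_ord0.
apply/morreyP; exists (C `^ p^-1); first exact: powR_ge0.
move=> m N; rewrite morrey_term_le ?powR_ge0// -powRrM mulVf ?gt_eqF// powRr1//.
under eq_bigr do rewrite /= fE ?half_decay_ge0//.
rewrite mulrC.
apply: le_trans (sum_powR_le (u := fun k => half_decay s (m - N%:Z + k%:Z)) p0 pq _ _) _ => //.
  by move=> i; exact: half_decay_ge0.
rewrite ler_wpM2l ?powR_ge0// lerD2l.
apply: le_trans (sum_riemannR_le N.*2.+1 sq1).
under eq_bigr do rewrite half_decay_powR//.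
by apply: sum_half_decay_le; lra.
Qed.

Lemma half_decay_not_morrey (R : realType) (V : normedZmodType R) (f : R -> V)
    (p q s : R) : (forall r, 0 <= r -> `|f r| = r) ->
  0 < p -> 0 <= s -> s < q^-1 -> ~ morrey V p q (f \o half_decay s).
Proof.
move=> fE p0 s0 sq /morreyP[M M0 hM].
set e := q^-1 - s; have e0 : 0 < e by rewrite subr_gt0.
(* Chosen so that the window size [n = 2N+1] exceeds [M^(1/e)], that is, [n^e > M]. *)
pose N := Num.truncn (M `^ e^-1).
have MN : M `^ e^-1 < N.*2.+1%:R.
  apply: lt_le_trans (Num.Theory.truncnS_gt _) _; rewrite ler_nat -/N; lia.
(* Centre and radius are both [N], so the window is [0..2N] and misses the zero half of the
   sequence. *)
have := hM N%:Z N; rewrite morrey_term_le// subrr.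
under eq_bigr do rewrite add0r /= fE ?powR_ge0// -powRrM mulNr.
set n := N.*2.+1 in MN *; have n0 : 0 < n%:R :> R by rewrite ltr0n.
apply/negP; rewrite -ltNge.
apply: (@lt_le_trans _ _ (n%:R * n%:R `^ (- (s * p)))); last first.
  rewrite mulr_natl -[X in _ *+ X]card_ord -sumr_const; apply: ler_sum => k _.
  rewrite 2!powRN lef_pV2 ?posrE ?powR_gt0// ge0_ler_powR ?nnegrE//.
    by rewrite mulr_ge0// ltW.
  by rewrite ler_nat.
have -> : n%:R * n%:R `^ (- (s * p)) = (n%:R `^ e) `^ p * n%:R `^ (1 - p / q).
  rewrite -powRrM -[X in X * _]powRr1 ?ltW// -!powRD ?(gt_eqF n0) ?implybT//.
  by congr (_ `^ _); rewrite /e; ring.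
rewrite ltr_pM2r ?powR_gt0// gt0_ltr_powR ?nnegrE ?powR_ge0//.
by rewrite ltNge -[e]invrK powR_inv_le ?invr_gt0 ?(ltW n0)// -ltNge.
Qed.

(** Carries the real counterexample to either kind of scalars; Morrey norms see only absolute
    values. *)
Lemma scalar_field_norm_lift (R : realType) (k : scalar_kind) :
  exists f : R -> scalar_field R k, forall r, 0 <= r -> `|f r| = r.
Proof.
case: k; first by exists id => r /= /ger0_norm.
exists (fun r => (r%:C)%C) => r r0.
by rewrite /= /Num.norm /= expr0n addr0 sqrtr_sqr ger0_norm.
Qed.

Theorem theorem2p6 (R : realType) (k : scalar_kind) (p1 q1 p2 q2 : R)
    (hp1 : 1 <= p1) (hpq1 : p1 <= q1) (hp2 : 1 <= p2) (hpq2 : p2 <= q2) :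
  (p1 <= p2 -> q1 / q2 <= p1 / p2 ->
     morrey (scalar_field R k) p1 q1 `<=` morrey (scalar_field R k) p2 q2 /\
     (forall x : int -> scalar_field R k, morrey (scalar_field R k) p1 q1 x ->
        (morrey_norm p2 q2 x <= morrey_norm p1 q1 x)%E)) /\
  ((p1 < p2 /\ q1 / q2 <= p1 / p2) \/ (p1 <= p2 /\ q1 / q2 < p1 / p2) ->
     morrey (scalar_field R k) p2 q2 `\` morrey (scalar_field R k) p1 q1 !=set0).
Proof.
have [p10 q10] : 0 < p1 /\ 0 < q1 by lra.
have [p20 q20] : 0 < p2 /\ 0 < q2 by lra.
split=> [p12 hq|hpq].
- have norm_le x : morrey (scalar_field R k) p1 q1 x ->
      (morrey_norm p2 q2 x <= morrey_norm p1 q1 x)%E.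
    exact: morrey_norm_mono.
  split; last exact: norm_le.
  by move=> x xM; apply: le_lt_trans (norm_le x xM) _; exact: xM.
- have q12 : q1 < q2.
    rewrite -[q2]mul1r -ltr_pdivrMr//.
    (* Each alternative makes one inequality strict in [q1/q2 <= p1/p2 <= 1]. *)
    case: hpq => -[h1 h2].
      by apply: le_lt_trans h2 _; rewrite ltr_pdivrMr// mul1r.
    by apply: lt_le_trans h2 _; rewrite ler_pdivrMr// mul1r.
  have q21 : q2^-1 < q1^-1 by rewrite ltf_pV2.
  have [f fE] := scalar_field_norm_lift R k.
  pose s := (q1^-1 + q2^-1) / 2.
  have [s0 s1 s2] : [/\ 0 < q2^-1, q2^-1 < s & s < q1^-1].
    by split; rewrite ?invr_gt0// /s; lra.
  exists (f \o half_decay s); split; first exact: half_decay_morrey.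
  by apply: half_decay_not_morrey => //; lra.
Qed.
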